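(* The following three statements hold. (i) There are an $n$ and $(v_0,v)\in\mathbb{R}^{n+1}$ such that $\mathrm{E\text{-}CG}(v_0,v)\in\mathcal{F}_1$ and there is no scalar $\lambda>0$ with $\lambda\cdot \mathrm{E\text{-}CG}(v_0,v)\in\mathcal{F}_0$. (ii) There are an $n$ and $(v_0,v)\in\mathbb{R}^{n+1}$ such that $\mathrm{E\text{-}CG}(v_0,v)\in\mathcal{F}_2$ and there is no scalar $\lambda>0$ with $\lambda\cdot \mathrm{E\text{-}CG}(v_0,v)\in\mathcal{F}_1$. (iii) There are an $n$ and $(v_0,v)\in\mathbb{R}^{n+1}$ such that there is no scalar $\lambda>0$ with $\lambda\cdot \mathrm{E\text{-}CG}(v_0,v)\in\mathcal{F}_2$.
   Context: For $v_0\in\mathbb{R}$ and $v\in\mathbb{R}^n$, $\mathrm{E\text{-}CG}(v_0,v)=(\alpha,\beta,\gamma)\in\mathbb{R}^{n+\binom n2+1}$ is the coefficient vector with $\alpha_i=\lceil v_i^2+2v_iv_0\rceil$ for $i\in\{1,\dots,n\}$, $\beta_{ij}=\lceil 2v_iv_j\rceil$ for $1\le i<j\le n$, and $\gamma=\lfloor v_0^2\rfloor$. It represents the Eigen-CG inequality $\sum_{i<j}\beta_{ij}X_{i,j}+\sum_i\alpha_ix_i+\gamma\ge 0$. For a given $n$, define the following sets of coefficient vectors (with $v_0\in\mathbb{R}$, $v\in\mathbb{R}^n$ throughout): $\mathcal{F}_0=\{\mathrm{E\text{-}CG}(v_0,v): v\in\mathbb{Z}^n,\ v_0+1/2\in\mathbb{Z}\}$;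 $\mathcal{F}_1=\{\mathrm{E\text{-}CG}(v_0,v): v\in\mathbb{Z}^n,\ 2v_iv_0\in\mathbb{Z}\ \forall i\}$; $\mathcal{F}_2=\{\mathrm{E\text{-}CG}(v_0,v): v_i^2\in\mathbb{Z}\ \forall i,\ 2v_iv_j\in\mathbb{Z}\ \forall i\ne j,\ 2v_iv_0\in\mathbb{Z}\ \forall i\}$. *)

(* Defs.v *)
From mathcomp Require Import all_boot all_order all_algebra.
From mathcomp Require Import boolp classical_sets reals.

Set Implicit Arguments.
Unset Strict Implicit.
Unset Printing Implicit Defensive.

Import Order.TTheory GRing.Theory Num.Theory.
Local Open Scope classical_set_scope.
Local Open Scope ring_scope.

Definition pairs (n : nat) : finType := {p : 'I_n * 'I_n | (p.1 < p.2)%N}.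

(* R^(n + binom n 2 + 1), split as (alpha, beta, gamma). [R^o] is [R] seen as a
   module over itself, so that [*:] scales all three blocks. *)
Definition coefs (R : realType) (n : nat) : lmodType R :=
  ('rV[R]_n * {ffun pairs n -> R^o} * R^o)%type.

Definition ECG (R : realType) (n : nat) (v0 : R) (v : 'rV[R]_n) : coefs R n :=
  (\row_i (Num.ceil (v ord0 i ^+ 2 + 2 * v ord0 i * v0))%:~R,
   [ffun p : pairs n =>
      (Num.ceil (2 * v ord0 (val p).1 * v ord0 (val p).2))%:~R : R^o],
   (Num.floor (v0 ^+ 2))%:~R : R^o).

Definition F0 (R : realType) (n : nat) : set (coefs R n) :=
  [set c | exists (v0 : R) (v : 'rV[R]_n),
    [/\ forall i, v ord0 i \is a Num.int,
        v0 + 1 / 2 \is a Num.int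
      & c = ECG v0 v]].

Definition F1 (R : realType) (n : nat) : set (coefs R n) :=
  [set c | exists (v0 : R) (v : 'rV[R]_n),
    [/\ forall i, v ord0 i \is a Num.int,
        forall i, 2 * v ord0 i * v0 \is a Num.int
      & c = ECG v0 v]].

Definition F2 (R : realType) (n : nat) : set (coefs R n) :=
  [set c | exists (v0 : R) (v : 'rV[R]_n),
    [/\ forall i, v ord0 i ^+ 2 \is a Num.int,
        forall i j, i != j -> 2 * v ord0 i * v ord0 j \is a Num.int,
        forall i, 2 * v ord0 i * v0 \is a Num.int
      & c = ECG v0 v]].

(* Main.v *)
Require Import Defs.
From mathcomp Require Import all_boot all_order all_algebra.
From mathcomp Require Import boolp classical_sets reals.
From mathcomp Require Import ring lra zify.

Set Implicit Arguments.
Unset Strict Implicit.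
Unset Printing Implicit Defensive.

Import Order.TTheory GRing.Theory Num.Theory.
Local Open Scope ring_scope.

(** Every vector of the three families comes from a pair (w0, w) at which the
    expressions under the ceilings are already integers, so that
    alpha_i = w_i^2 + 2 w_i w0 and beta_ij = 2 w_i w_j hold exactly
    ([scaled_ECG_exact]); only the floor defining gamma still rounds.  Being
    proportional to a member of a family therefore becomes a system of
    polynomial equations, and n = 2 suffices to make it inconsistent.

    - (i) Take v = (1, 1) and v0 = 0, with coefficients alpha = (1, 1) and
      beta = 2.  The relation alpha_1 = alpha_2 with 2 alpha_1 + beta <> 0
      forces w_1 = w_2 ([equal_alpha]), and then 2 alpha_1 = beta forces
      w0 = 0, which is not a half-integer.

    - (ii) Take v = (sqrt 3, sqrt 3) and v0 = 2 / sqrt 3, with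
      alpha = (7, 7), beta = 6 and gamma = floor (4/3) = 1.  After scaling by
      l, again w_1 = w_2, with w_1^2 = 3 l and w0^2 = 4 l / 3.  The coefficient
      gamma now reads floor (4 l / 3) = l, so l is an integer smaller than 3,
      and w_1^2 would be 3 or 6, neither of which is a square.

    - (iii) Take v = (1, -1/4) and v0 = 0.  Rounding turns beta = -1/2 into 0
      and alpha_2 = 1/16 into 1, whereas w_1 w_2 = 0 makes one of the two
      alphas vanish. *)

Section Integrality.

Variables (R : realType) (n : nat) (w0 : R) (w : 'rV[R]_n).

Lemma int_row_exact :
  (forall i, w ord0 i \is a Num.int) ->
  (forall i, w ord0 i ^+ 2 \is a Num.int) /\
  (forall i j, i != j -> 2 * w ord0 i * w ord0 j \is a Num.int).
Proof.
move=> w_int; split=> [i|i j _]; first exact: rpredX.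
by rewrite !rpredM ?natr_int.
Qed.

Lemma half_int_exact :
  (forall i, w ord0 i \is a Num.int) -> w0 + 1 / 2 \is a Num.int ->
  forall i, 2 * w ord0 i * w0 \is a Num.int.
Proof.
move=> w_int w0_half i.
have -> : 2 * w ord0 i * w0 = w ord0 i * (2 * (w0 + 1 / 2) - 1) by field.
by rewrite !(rpredM, rpredB, natr_int, int_num1).
Qed.

(** The integrality hypotheses are those of the largest family, and the smaller families
    satisfy them by the two previous lemmas; hence one set of equations
    describes all three. *)
Lemma scaled_ECG_exact (l v0 : R) (v : 'rV[R]_n) :
  (forall i, w ord0 i ^+ 2 \is a Num.int) ->
  (forall i j, i != j -> 2 * w ord0 i * w ord0 j \is a Num.int) ->
  (forall i, 2 * w ord0 i * w0 \is a Num.int) ->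
  l *: ECG v0 v = ECG w0 w ->
  [/\ forall i, w ord0 i ^+ 2 + 2 * w ord0 i * w0 =
        l * (Num.ceil (v ord0 i ^+ 2 + 2 * v ord0 i * v0))%:~R,
      forall i j : 'I_n, (i < j)%N -> 2 * w ord0 i * w ord0 j =
        l * (Num.ceil (2 * v ord0 i * v ord0 j))%:~R
    & (Num.floor (w0 ^+ 2))%:~R = l * (Num.floor (v0 ^+ 2))%:~R].
Proof.
pose T := ('rV[R]_n * {ffun pairs n -> R^o} * R^o)%type.
move=> sq_int prod_int lin_int eqE; split=> [i|i j lt_ij|].
- have := congr1 (fun c : T => c.1.1 ord0 i) eqE; rewrite /= !mxE => ->.
  by rewrite ceilK // rpredD.
- have := congr1 (fun c : T => c.1.2 (Sub (i, j) lt_ij)) eqE.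
  rewrite /= !ffunE /= => beta_eq.
  rewrite -[LHS]ceilK; first exact: esym beta_eq.
  by rewrite prod_int // neq_ltn lt_ij.
- by have := congr1 (fun c : T => c.2) eqE.
Qed.

End Integrality.

(** The difference of the two alphas factors as (a - b) (a + b + 2 w), and the
    second factor vanishes only if x = - a b. *)
Lemma equal_alpha (R : realType) (a b w x : R) :
  a ^+ 2 + 2 * a * w = x -> b ^+ 2 + 2 * b * w = x -> x + a * b != 0 -> a = b.
Proof.
move=> ax bx xab; apply/eqP; rewrite -subr_eq0.
have : (a - b) * (a + b + 2 * w) == 0.
  by apply/eqP; lra.
rewrite mulf_eq0 => /orP[//|/eqP sum0].
have b_eq : b = - (a + 2 * w) by lra.
by case/eqP: xab; rewrite -ax b_eq; ring.
Qed.

Definition row2 (R : realType) (a b : R) : 'rV[R]_2 :=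
  \row_i (if i == ord0 then a else b).

Lemma ones_not_F0 (R : realType) (l : R) :
  0 < l -> ~ F0 (l *: ECG 0 (row2 1 1)).
Proof.
move=> l_gt0 [w0 [w [w_int w0_half]]].
have [sq_int prod_int] := int_row_exact w_int.
have lin_int := half_int_exact w_int w0_half.
case/(scaled_ECG_exact sq_int prod_int lin_int) => alphaE betaE _.
have := alphaE ord0; have := alphaE ord_max; have := betaE ord0 ord_max isT.
rewrite !mxE /= !mulr0 !addr0 !mulr1 expr1n ceil1 ceilK ?natr_int //.
set a := w ord0 ord0; set b := w ord0 ord_max => ab bl al.
have abl : a * b = l by lra.
have eq_ab : a = b.
  by apply: (equal_alpha al bl); rewrite abl mulr1; apply: lt0r_neq0; lra.
have a2 : a ^+ 2 = l by rewrite expr2 [X in _ * X]eq_ab.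
have /eqP : a * w0 = 0 by lra.
rewrite mulf_eq0 => /orP[/eqP a0|/eqP w00].
  by move: l_gt0; rewrite -a2 a0 expr0n ltxx.
move: w0_half; rewrite w00 add0r => /intrP[m half_m].
(* With w0 = 0 the half-integrality of w0 says that 1/2 = m is an integer. *)
have : 2 * m = 1 :> int.
  by apply: (@intr_inj R); rewrite rmorphM /= -half_m; field.
lia.
Qed.

(** The irrational factor sqrt 3 disappears from all products v_i v_j and
    v_i v0, so alpha and beta are exact although v is not integral. *)
Lemma F2_sqrt3 (R : realType) (s := Num.sqrt 3 : R) :
  F2 (ECG (2 / s) (row2 s s)).
Proof.
have s2 : s ^+ 2 = 3 by rewrite sqr_sqrtr.
have s_neq0 : s != 0 by rewrite sqrtr_eq0 -ltNge.
have sE (i : 'I_2) : row2 s s ord0 i = s by rewrite mxE if_same.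
exists (2 / s), (row2 s s); split=> // [i|i j _|i]; rewrite !sE.
- by rewrite s2 natr_int.
- by rewrite -mulrA -expr2 s2 -natrM natr_int.
- by rewrite (_ : _ * _ = 4) ?natr_int //; field.
Qed.

Lemma sqr_int_neq3_neq6 (m : int) : m ^+ 2 != 3 /\ m ^+ 2 != 6.
Proof.
rewrite expr2; case: m => [[|[|[|n]]]|[|[|n]]] //; split; apply/eqP; nia.
Qed.

Lemma F2_sqrt3_not_F1 (R : realType) (l : R) (s := Num.sqrt 3 : R) :
  0 < l -> ~ F1 (l *: ECG (2 / s) (row2 s s)).
Proof.
have s2 : s ^+ 2 = 3 by rewrite sqr_sqrtr.
have s_neq0 : s != 0 by rewrite sqrtr_eq0 -ltNge.
move=> l_gt0 [w0 [w [w_int lin_int]]].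
have [sq_int prod_int] := int_row_exact w_int.
case/(scaled_ECG_exact sq_int prod_int lin_int) => alphaE betaE.
have := alphaE ord0; have := alphaE ord_max; have := betaE ord0 ord_max isT.
have /intrP[m a_m] := w_int ord0.
rewrite !mxE /=.
have -> : s ^+ 2 + 2 * s * (2 / s) = 7 by rewrite s2; field.
have -> : 2 * s * s = 6 by rewrite -mulrA -expr2 s2; ring.
have -> : Num.floor ((2 / s) ^+ 2) = 1.
  by rewrite expr_div_n s2; apply: floor_def; apply/andP; split; lra.
rewrite !ceilK ?natr_int // mulr1 a_m.
set a : R := m%:~R; set b := w ord0 ord_max => ab bl al floor_l.
have abl : a * b = 3 * l by lra.
have eq_ab : a = b.
  by apply: (equal_alpha al bl); rewrite abl; apply: lt0r_neq0; lra.
have a2 : a ^+ 2 = 3 * l by rewrite expr2 [X in _ * X]eq_ab.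
have w02 : w0 ^+ 2 = 4 / 3 * l.
  have aw : a * w0 = 2 * l by lra.
  have : (3 * l) * w0 ^+ 2 = (3 * l) * (4 / 3 * l).
    by rewrite -{1}a2 -exprMn aw; field.
  by apply: mulfI; apply: lt0r_neq0; lra.
set k := Num.floor (w0 ^+ 2) in floor_l.
have k_gt0 : 0 < k by rewrite -(ltr0z R) floor_l.
(* k = l and 4 l / 3 < k + 1 give l < 3. *)
have k_lt3 : k < 3.
  have := floorD1_gt (w0 ^+ 2); rewrite -/k w02 rmorphD /= floor_l => lt_l.
  by rewrite -(ltr_int R) floor_l; lra.
have m2 : m ^+ 2 = 3 * k.
  by apply: (@intr_inj R); rewrite rmorphXn rmorphM /= floor_l.
have [m3 m6] := sqr_int_neq3_neq6 m.
have [k1|k2] : k = 1 \/ k = 2 by lia.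
- by case/eqP: m3; rewrite m2 k1.
- by case/eqP: m6; rewrite m2 k2.
Qed.

Lemma ECG_not_F2 (R : realType) (l : R) :
  0 < l -> ~ F2 (l *: ECG 0 (row2 1 (- (1 / 4)))).
Proof.
move=> l_gt0 [w0 [w [sq_int prod_int lin_int]]].
case/(scaled_ECG_exact sq_int prod_int lin_int) => alphaE betaE _.
have := alphaE ord0; have := alphaE ord_max; have := betaE ord0 ord_max isT.
rewrite !mxE /= !mulr0 !addr0 expr1n ceil1.
have -> : Num.ceil (2 * 1 * - (1 / 4) : R) = 0.
  by apply: ceil_def; apply/andP; split; lra.
have -> : Num.ceil ((- (1 / 4)) ^+ 2 : R) = 1.
  by apply: ceil_def; apply/andP; split; lra.
(* beta = 0 makes one of the two entries of w vanish, hence also its alpha. *)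
move=> /eqP; rewrite mulr0 -mulrA !mulf_eq0 pnatr_eq0 /= mulr1.
by case/orP=> /eqP ->; rewrite expr0n /= mulr0 mul0r addr0 => *; lra.
Qed.

Theorem lemma2 (R : realType) :
  [/\ exists (n : nat) (v0 : R) (v : 'rV[R]_n),
        F1 (ECG v0 v) /\
        ~ (exists lambda : R, 0 < lambda /\ F0 (lambda *: ECG v0 v)),
      exists (n : nat) (v0 : R) (v : 'rV[R]_n),
        F2 (ECG v0 v) /\
        ~ (exists lambda : R, 0 < lambda /\ F1 (lambda *: ECG v0 v))
    & exists (n : nat) (v0 : R) (v : 'rV[R]_n),
        ~ (exists lambda : R, 0 < lambda /\ F2 (lambda *: ECG v0 v))].
Proof.
split.
- exists 2, 0, (row2 1 1); split; last by case=> l [/ones_not_F0].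
  exists 0, (row2 1 1); split=> // i; first by rewrite mxE if_same int_num1.
  by rewrite mulr0 int_num0.
- exists 2, (2 / Num.sqrt 3), (row2 (Num.sqrt 3) (Num.sqrt 3)).
  by split; [exact: F2_sqrt3 | case=> l [/F2_sqrt3_not_F1]].
- by exists 2, 0, (row2 1 (- (1 / 4))); case=> l [/ECG_not_F2].
Qed.
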